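(* The set $\mathbb A\subseteq\mathbb R$ (the explicit set defined in the context) has strictly positive Hausdorff dimension.
   Context: Definition of $\mathbb A$. Let $\omega_3=\frac43\pi$. For $A>0$ let $R_A>1$ be given by $A=\omega_3(R_A^2-1)^{3/2}$, and $\gamma_A=\frac1\pi\arctan\big(\sqrt{R_A^2-1}\big)=\frac1\pi\arctan\big((A/\omega_3)^{1/3}\big)$. For $x>1$ let $G_A(x)=\arctan(\sqrt{x^2-1})-\arctan(\sqrt{R_A^2-1})$. For $\alpha,\beta\in(0,\pi/2)$, $\alpha\ne\beta$, let $$F_{A,+}(\alpha,\beta)=G_A\!\left(R_A\frac{\sin(\alpha-\beta)}{\sin\alpha-\sin\beta}\right),\qquad F_{A,-}(\alpha)=-G_A(R_A\cos\alpha)$$ (the latter whenever $R_A\cos\alpha>1$). For $k\ge1$ let $\delta_{A,k}=\pi\min_{j\in\mathbb Z}|(2k-1)\gamma_A-j|$. For $k\ge2$ let $\alpha_{A,k}=\min\{\delta_{A,1},\dots,\delta_{A,k}\}$ and $\beta_{A,k}=\min\big(\{\delta_{A,1},\dots,\delta_{A,k}\}\setminus\{\alpha_{A,k}\}\big)$. Condition $C(A,k)$ (for $k\ge 2$) is the pair of inequalities $$F_{A,+}(\alpha_{A,k},\beta_{A,k})<\delta_{A,k+1},\qquad F_{A,-}(\alpha_{A,k})<\delta_{A,k+1}.$$ $\mathbb A$ is the set of all $A>8\omega_3$ such that $\gamma_A$ is irrational and condition $C(A,k)$ holds for every $k\ge2$. (For $A>8\omega_3$ with $\gamma_A$ irrational,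 all quantities occurring in $C(A,k)$, $k\ge2$, are well defined.) *)

(* Defs.v *)
From HB Require Import structures.
From mathcomp Require Import all_boot all_order all_algebra.
From mathcomp Require Import all_classical all_reals all_analysis.

Set Implicit Arguments.
Unset Strict Implicit.
Unset Printing Implicit Defensive.

Import Order.TTheory GRing.Theory Num.Theory.
Import numFieldNormedType.Exports.

Local Open Scope classical_set_scope.
Local Open Scope ring_scope.

(** * Hausdorff dimension of subsets of the real line *)

Section Hausdorff.
Context {R : realType}.
Implicit Types (U A : set R) (F : (set R)^nat) (s d : R).
Local Open Scope ereal_scope.

(* For U = set0 this is ereal_sup set0 = -oo, which is below every mesh d;
   [hausdorff_gauge] therefore treats the empty set separately. *)
Definition diam U : \bar R :=
  ereal_sup [set (`|p.1 - p.2|%R)%:E | p in U `*` U].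

(* diam(U)^s, with the usual conventions that the empty set contributes 0 and
   that a nonempty set contributes 1 when s = 0 (as x `^ 0 = 1 for all x). *)
Definition hausdorff_gauge s U : \bar R :=
  if U == set0 then 0 else diam U `^ s.

Definition mesh_cover d A : set (set R)^nat :=
  [set F | A `<=` \bigcup_n F n /\ forall n, diam (F n) <= d%:E].

Definition hausdorff_content s d A : \bar R :=
  ereal_inf [set \sum_(n <oo) hausdorff_gauge s (F n) | F in mesh_cover d A].

(* The content is nonincreasing in d, so its limit as d tends to 0 from the
   right is its supremum over d > 0. *)
Definition hausdorff_measure s A : \bar R :=
  ereal_sup [set hausdorff_content s d A | d in [set d | (0 < d)%R]].

Definition hausdorff_dim A : \bar R :=
  ereal_inf [set s%:E | s in [set s | (0 <= s)%R /\ hausdorff_measure s A = 0]].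

End Hausdorff.

(** * The set AA *)

Section AA.
Context {R : realType}.
Implicit Types (A x alpha beta : R) (k j : nat).

Definition omega3 : R := 4 / 3 * pi.

Definition RA_set A : set R :=
  [set r | 1 < r /\ A = omega3 * (r ^+ 2 - 1) `^ (3 / 2)].

(* The unique element of [RA_set A] when 0 < A, see [RA_setE] below. *)
Definition RA A : R := get (RA_set A).

Definition gammaA A : R := pi^-1 * atan (Num.sqrt (RA A ^+ 2 - 1)).

Definition GA A x : R :=
  atan (Num.sqrt (x ^+ 2 - 1)) - atan (Num.sqrt (RA A ^+ 2 - 1)).

Definition FAplus A alpha beta : R :=
  GA A (RA A * (sin (alpha - beta) / (sin alpha - sin beta))).

Definition FAminus A alpha : R := - GA A (RA A * cos alpha).

(* The infimum over the integers j is attained, see [deltaA_min] below.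
   The factor is 2k - 1 for k >= 1. *)
Definition deltaA A k : R :=
  pi * inf [set `|((2 * k)%:R - 1) * gammaA A - j%:~R| | j in [set: int]].

Definition deltas A k : set R := [set deltaA A j | j in [set j | 1 <= j <= k]%N].

(* Infima of finite sets, hence minima as soon as these sets are nonempty. *)
Definition alphaA A k : R := inf (deltas A k).

Definition betaA A k : R := inf (deltas A k `\` [set alphaA A k]).

Definition condC A k : Prop :=
  FAplus A (alphaA A k) (betaA A k) < deltaA A k.+1 /\
  FAminus A (alphaA A k) < deltaA A k.+1.

Definition AA : set R :=
  [set A | [/\ 8 * omega3 < A, irrational (gammaA A) &
               forall k, (2 <= k)%N -> condC A k]].

(** Consistency checks for the implicit definitions above. *)

Lemma omega3_gt0 : 0 < omega3.
Proof. by rewrite /omega3 mulr_gt0 ?pi_gt0// divr_gt0. Qed.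

Lemma RA_setE A : 0 < A ->
  RA_set A = [set Num.sqrt (1 + (A / omega3) `^ (2 / 3))].
Proof.
move=> A0; have o0 := omega3_gt0.
have Ao0 : 0 < A / omega3 by rewrite divr_gt0.
apply/seteqP; split=> r /=.
- move=> [r1 AE]; have r0 : 0 <= r by rewrite (le_trans _ (ltW r1)).
  have r21 : 0 <= r ^+ 2 - 1 by rewrite subr_ge0 expr_ge1// ltW.
  have -> : A / omega3 = (r ^+ 2 - 1) `^ (3 / 2).
    by rewrite AE mulrAC divff ?mul1r// gt_eqF.
  rewrite -powRrM (_ : 3 / 2 * (2 / 3) = 1); last first.
    by rewrite mulrA divfK ?divff// ?pnatr_eq0.
  by rewrite powRr1// addrC subrK sqrtr_sqr ger0_norm.
- move=> ->; have p0 : 0 < (A / omega3) `^ (2 / 3) by exact: powR_gt0.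
  split.
    by rewrite -[X in X < _]sqrtr1 ltr_sqrt ?ltrDl// addr_gt0.
  rewrite sqr_sqrtr ?addr_ge0// ?(ltW p0)// addrAC subrr add0r.
  rewrite -powRrM (_ : 2 / 3 * (3 / 2) = 1); last first.
    by rewrite mulrA divfK ?divff// ?pnatr_eq0.
  by rewrite powRr1 ?(ltW Ao0)// mulrC divfK// gt_eqF.
Qed.

Lemma gammaAE A : 0 < A -> gammaA A = pi^-1 * atan ((A / omega3) `^ (1 / 3)).
Proof.
move=> A0; rewrite /gammaA; congr (_ * atan _).
have Ao0 : 0 < A / omega3 by rewrite divr_gt0// omega3_gt0.
have -> : RA A = Num.sqrt (1 + (A / omega3) `^ (2 / 3)).
  by rewrite /RA RA_setE//; apply: (@getPex _ [set _]); eexists.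
rewrite sqr_sqrtr ?addr_ge0 ?powR_ge0// addrAC subrr add0r.
rewrite (_ : 2 / 3 = 1 / 3 * 2); last by rewrite mul1r mulrC.
by rewrite powRrM powR_mulrn ?powR_ge0// sqrtr_sqr ger0_norm// powR_ge0.
Qed.

Lemma deltaA_min A k :
  let c := ((2 * k)%:R - 1) * gammaA A in
  exists j0 : int, deltaA A k = pi * `|c - j0%:~R| /\
    forall j : int, `|c - j0%:~R| <= `|c - j%:~R|.
Proof.
set c := _ * gammaA A; cbv zeta.
pose f := Num.floor c.
have f1 : f%:~R <= c by exact: Num.Theory.floor_le.
have f2 : c < (f + 1)%:~R by exact: Num.Theory.floorD1_gt.
have out (j : int) : `|c - f%:~R| <= `|c - j%:~R| \/ `|c - (f + 1)%:~R| <= `|c - j%:~R|.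
  have [jf|fj] := leP j f.
    have jfR : j%:~R <= f%:~R :> R by rewrite ler_int.
    left; rewrite !ger0_norm ?subr_ge0 ?(le_trans jfR)//.
    by rewrite lerD2l lerN2.
  have fjR : (f + 1)%:~R <= j%:~R :> R by rewrite ler_int lezD1.
  right; have cf := ltW f2; have cj := le_trans cf fjR.
  rewrite !ler0_norm ?subr_le0//.
  by rewrite !opprB lerD2r.
have [j0 j0P] : exists j0 : int, forall j : int, `|c - j0%:~R| <= `|c - j%:~R|.
  have [h|h] := leP `|c - f%:~R| `|c - (f + 1)%:~R|.
    by exists f => j; case: (out j) => //; exact: le_trans.
  by exists (f + 1) => j; case: (out j) => // /(le_trans (ltW h)).
exists j0; split => //; congr (pi * _).
have lbj : lbound [set `|c - j%:~R| | j in [set: int]] `|c - j0%:~R|.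
  by move=> _ [j _ <-]; exact: j0P.
apply/eqP; rewrite eq_le; apply/andP; split.
  by apply: ge_inf; [exists `|c - j0%:~R| | exists j0].
by apply: lb_le_inf => //; exists `|c - j0%:~R|; exists j0.
Qed.

End AA.

(* Main.v *)
Require Import Defs.
From mathcomp Require Import all_boot all_order all_algebra.
From mathcomp Require Import all_classical all_reals all_analysis.
From mathcomp Require Import ring lra zify.

Set Implicit Arguments.
Unset Strict Implicit.
Unset Printing Implicit Defensive.
Import Order.TTheory GRing.Theory Num.Theory.
Import numFieldNormedType.Exports.
Local Open Scope classical_set_scope.
Local Open Scope ring_scope.

(* For small angles [FAplus A alpha beta] is about [alpha * beta / (2 t)] and
   [FAminus A alpha] about [alpha ^ 2 / (2 t)], where [t = tan (pi * gammaA A)]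
   exceeds 2. Hence [condC A k] can only fail if [deltaA A k.+1] is far below
   the previous minima, which is impossible when [gammaA A] is badly
   approximable with small constants. Take
   [gammaA A = [0; 2, 1, 3, 2, a1, a2, ...]] with all [ai] equal to 2 or 4:
   the convergents from the third one on have odd denominators 3, 11, ..., so
   that [alphaA A k] and [betaA A k] are governed by the errors of consecutive
   convergents, whose ratios are bounded; only [k = 2] and the [k] in the stage
   of the denominator 3 need the explicit value of [deltaA A 1] or [deltaA A 3].
   Sending the binary digits of [z] in [0, 1] to the [ai] gives a map into [AA]
   with [|z - z'| ^ 5 <= K * |A z - A z'|], so the dimension is at least 1/5. *)

(** * The functions FAplus and FAminus *)

Lemma atan_sub_le {R : realType} (v u : R) : 0 <= v -> v <= u ->
  atan u - atan v <= (u - v) / (1 + v ^+ 2).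
Proof.
move=> v0 vu.
have [c /[!in_itv]/= /andP[vc cu] ->] :=
  MVT_segment vu (fun x _ => is_derive1_atan x)
    (continuous_subspaceT (@continuous_atan R)).
rewrite mulrC; apply: ler_wpM2l; first by rewrite subr_ge0.
rewrite lef_pV2 ?posrE ?ltr_wpDr ?sqr_ge0//.
by rewrite lerD2l lerXn2r ?nnegrE// (le_trans v0).
Qed.

Lemma sin_le_id {R : realType} (x : R) : 0 <= x -> sin x <= x.
Proof.
move=> x0.
have [c _] := MVT_segment x0 (fun y _ => is_derive_sin y)
  (continuous_subspaceT (@continuous_sin R)).
rewrite sin0 !subr0 => ->.
by rewrite -[leRHS]mul1r ler_wpM2r// cos_le1.
Qed.

Lemma cos_sqr_ge_half {R : realType} (x : R) : 0 <= x -> x <= pi / 4 ->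
  1 / 2 <= cos x ^+ 2.
Proof.
move=> x0 x4; have p0 := pi_gt0 R.
have : 0 <= cos (x + x) by apply: cos_ge0_pihalf; apply/andP; split; lra.
by have := cos2Dsin2 x; rewrite cosD; nra.
Qed.

(* The increment of the square root is rationalised, and one factor
   [(RA A) ^+ 2 = 1 + t ^+ 2] cancels the derivative of [atan] at [t]. *)
Lemma GA_mul_le {R : realType} (A t r : R) : 0 < t ->
    RA A ^+ 2 = 1 + t ^+ 2 -> 1 <= r ^+ 2 ->
  GA A (RA A * r) <= (r ^+ 2 - 1) / (2 * t).
Proof.
move=> t0 RE r1; rewrite /GA exprMn RE.
have -> : 1 + t ^+ 2 - 1 = t ^+ 2 by ring.
rewrite sqrtr_sqr gtr0_norm//.
set w2 := (1 + t ^+ 2) * r ^+ 2 - 1.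
have w2t : t ^+ 2 <= w2 by rewrite /w2; nra.
have w20 : 0 <= w2 by rewrite (le_trans _ w2t)// sqr_ge0.
set w := Num.sqrt w2.
have wE : w ^+ 2 = w2 by rewrite sqr_sqrtr.
have tw : t <= w by rewrite -[t]gtr0_norm// -sqrtr_sqr ler_wsqrtr.
apply: le_trans (atan_sub_le (ltW t0) tw) _.
rewrite ler_pdivrMr; last by nra.
rewrite mulrAC ler_pdivlMr; last by lra.
have -> : (r ^+ 2 - 1) * (1 + t ^+ 2) = w2 - t ^+ 2 by rewrite /w2; ring.
rewrite -wE; nra.
Qed.

(** With [x] and [y] the half-sum and half-difference of the angles, the quotient of sines is
    [cos y / cos x], whose square minus 1 is [sin a * sin b / cos x ^+ 2]. As [x <= pi / 4] and
    [2 <= t], the factor [t * cos x ^+ 2] is at least 1. *)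
Lemma FAplus_le {R : realType} (A t a b : R) : 2 <= t ->
    RA A ^+ 2 = 1 + t ^+ 2 -> 0 < a -> a <= b -> a + b <= pi / 2 ->
  FAplus A a b <= a * b / 2.
Proof.
move=> t2 RE a0 ab abp; have t0 : 0 < t by lra.
have p0 := pi_gt0 R.
have [<-|aNb] := eqVneq a b.
  rewrite /FAplus !subrr invr0 !mulr0 /GA expr0n/= sub0r.
  rewrite ler0_sqrtr ?lerN10// atan0 sub0r RE (addrC 1) addrK sqrtr_sqr.
  rewrite gtr0_norm// (le_trans (y := 0))//; last by nra.
  by rewrite oppr_le0 -[leLHS]atan0 ltW// lt_atan.
have {}ab : a < b by rewrite lt_neqAle aNb.
pose x := (a + b) / 2; pose y := (b - a) / 2.
have aE : a = x - y by rewrite /x /y; field.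
have bE : b = x + y by rewrite /x /y; field.
have cx : 1 / 2 <= cos x ^+ 2 by apply: cos_sqr_ge_half; rewrite /x; lra.
have sy : 0 < sin y by apply: sin_gt0_pihalf; rewrite /y; apply/andP; split; lra.
have cx0 : 0 < cos x by apply: cos_gt0_pihalf; rewrite /x; apply/andP; split; lra.
have rE : sin (a - b) / (sin a - sin b) = cos y / cos x.
  have -> : a - b = - (y + y) by rewrite aE bE; ring.
  rewrite sinN sinD aE bE sinB sinD; field.
  by rewrite gt_eqF//= lt_eqF//; have := mulr_gt0 cx0 sy; lra.
rewrite /FAplus rE.
have id2 : (cos y / cos x) ^+ 2 - 1 = sin a * sin b / cos x ^+ 2.
  rewrite aE bE sinB sinD.
  have h1 := cos2Dsin2 x; have h2 := cos2Dsin2 y.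
  have -> : (sin x * cos y - cos x * sin y) * (sin x * cos y + cos x * sin y)
    = cos y ^+ 2 - cos x ^+ 2.
    transitivity (sin x ^+ 2 * cos y ^+ 2 - cos x ^+ 2 * sin y ^+ 2); first by ring.
    have -> : sin x ^+ 2 = 1 - cos x ^+ 2 by rewrite -h1; ring.
    have -> : sin y ^+ 2 = 1 - cos y ^+ 2 by rewrite -h2; ring.
    ring.
  by field; rewrite gt_eqF.
have sa : 0 < sin a by apply: sin_gt0_pihalf; apply/andP; split; lra.
have sb : 0 < sin b by apply: sin_gt0_pihalf; apply/andP; split; lra.
have sa1 := sin_le_id (ltW a0).
have sb1 : sin b <= b by apply: sin_le_id; lra.
have c20 : 0 < cos x ^+ 2 by lra.
have r0 : 0 <= sin a * sin b / cos x ^+ 2 by rewrite divr_ge0 ?mulr_ge0 ?ltW.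
apply: le_trans (GA_mul_le t0 RE _) _; first by rewrite -subr_ge0 id2.
rewrite id2 ler_pdivrMr; last by lra.
rewrite ler_pdivrMr//.
have hs : sin a * sin b <= a * b by apply: ler_pM => //; exact: ltW.
apply: le_trans hs _.
have ab0 : 0 < a * b by rewrite mulr_gt0//; lra.
have : 1 <= t * cos x ^+ 2 by nra.
have -> : a * b / 2 * (2 * t) * cos x ^+ 2 = a * b * (t * cos x ^+ 2) by field.
nra.
Qed.

(** The derivative of [atan] is bounded at the lower end [w], where
    [1 + w ^+ 2 = (t ^+ 2 + 1) * cos a ^+ 2]; this cancels the first factor of [t ^+ 2 - w ^+ 2 = (t
    ^+ 2 + 1) * sin a ^+ 2]. *)
Lemma FAminus_le {R : realType} (A t a : R) : 2 <= t ->
    RA A ^+ 2 = 1 + t ^+ 2 -> 0 < a -> a <= pi / 4 ->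
  FAminus A a <= a ^+ 2.
Proof.
move=> t2 RE a0 a4; have t0 : 0 < t by lra.
have p0 := pi_gt0 R.
rewrite /FAminus /GA exprMn RE (addrC 1) addrK sqrtr_sqr gtr0_norm// opprB.
have c2 := cos_sqr_ge_half (ltW a0) a4.
have cs := cos2Dsin2 a.
have s0 : 0 < sin a by apply: sin_gt0_pihalf; apply/andP; split; lra.
have s1 := sin_le_id (ltW a0).
set w2 := (t ^+ 2 + 1) * cos a ^+ 2 - 1.
have w21 : 1 <= w2 by rewrite /w2; nra.
set w := Num.sqrt w2.
have wE : w ^+ 2 = w2 by rewrite sqr_sqrtr// (le_trans ler01).
have w0 : 0 <= w by rewrite sqrtr_ge0.
have s2 : sin a ^+ 2 <= a ^+ 2 by rewrite lerXn2r ?nnegrE// ltW.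
have s20 : 0 < sin a ^+ 2 by rewrite exprn_gt0.
have w2E : w2 = t ^+ 2 - (t ^+ 2 + 1) * sin a ^+ 2.
  by rewrite /w2 (_ : cos a ^+ 2 = 1 - sin a ^+ 2); [ring|rewrite -cs; ring].
have wt : w <= t.
  rewrite -[leRHS]gtr0_norm// -sqrtr_sqr ler_wsqrtr// w2E.
  rewrite gerBl; nra.
apply: le_trans (atan_sub_le w0 wt) _.
rewrite ler_pdivrMr ?ltr_wpDr ?sqr_ge0// wE.
have -> : 1 + w2 = (t ^+ 2 + 1) * cos a ^+ 2 by rewrite /w2; ring.
have h : (t - w) * (t + w) = (t ^+ 2 + 1) * sin a ^+ 2.
  by transitivity (t ^+ 2 - w ^+ 2); [ring | rewrite wE w2E; ring].
have h1 : (t - w) * 2 <= (t ^+ 2 + 1) * sin a ^+ 2 by rewrite -h; nra.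
have h2 : (t ^+ 2 + 1) * sin a ^+ 2 <= (t ^+ 2 + 1) * a ^+ 2.
  by rewrite ler_wpM2l// addr_ge0// sqr_ge0.
have h3 : 0 <= (t ^+ 2 + 1) * a ^+ 2.
  by rewrite mulr_ge0 ?sqr_ge0// addr_ge0 ?sqr_ge0.
have -> : a ^+ 2 * ((t ^+ 2 + 1) * cos a ^+ 2) =
    (t ^+ 2 + 1) * a ^+ 2 * cos a ^+ 2 by ring.
nra.
Qed.

(* With [b = pi / 2 - a <= pi / 7] one would have [0 <= sin (7 * b)], but if
   [tan b = 1 / 2] this sine has the sign of [Im ((2 + i) ^ 7) = -29]. *)
Lemma atan2_lt {R : realType} : atan 2 < 5 / 14 * pi :> R.
Proof.
have p0 := pi_gt0 R.
rewrite ltNge; apply/negP => h.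
have h2 := @atan_ltpi2 R 2.
pose b : R := pi / 2 - atan 2.
have b7 : 7 * b <= pi by rewrite /b; lra.
have b0 : 0 < b by rewrite /b; lra.
have cb : 0 < cos b by apply: cos_gt0_pihalf; apply/andP; split; lra.
have ca : 0 < cos (atan 2 : R).
  by apply: cos_gt0_pihalf; rewrite atan_ltpi2 atan_gtNpi2.
have sb : sin b = cos b / 2.
  rewrite /b sinB cosB sin_pihalf cos_pihalf !mul0r !mul1r subr0 add0r.
  have := @atanK R 2; rewrite /tan => E.
  by rewrite -[X in X / 2](divfK (lt0r_neq0 ca)) E; field.
have s2 : sin (b + b) = cos b ^+ 2 by rewrite sinD sb; field.
have c2 : cos (b + b) = 3 / 4 * cos b ^+ 2 by rewrite cosD sb; field.
have s4 : sin (b + b + (b + b)) = 3 / 2 * cos b ^+ 4.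
  by rewrite sinD s2 c2; field.
have c4 : cos (b + b + (b + b)) = - (7 / 16) * cos b ^+ 4.
  by rewrite cosD s2 c2; field.
have s3 : sin (b + b + b) = 11 / 8 * cos b ^+ 3.
  by rewrite sinD s2 c2 sb; field.
have c3 : cos (b + b + b) = 1 / 4 * cos b ^+ 3.
  by rewrite cosD s2 c2 sb; field.
have s7 : sin (b + b + (b + b) + (b + b + b)) = - (29 / 128) * cos b ^+ 7.
  by rewrite sinD s4 c4 s3 c3; field.
have : 0 <= sin (b + b + (b + b) + (b + b + b)).
  by apply: sin_ge0_pi; apply/andP; split; lra.
rewrite s7; have : 0 < cos b ^+ 7 by rewrite exprn_gt0.
lra.
Qed.

(** * Best approximation *)

(* The lattice point is written in the basis [(q, p), (q', p')]; as
   [0 < n < q'], its two coordinates cannot have the same sign. *)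
Lemma best_approximation {R : realDomainType} (g e e' sg : R) (q p q' p' d : int)
    (n j : int) :
    `|sg| = 1 -> 0 <= e' ->
    q%:~R * g - p%:~R = sg * e -> q'%:~R * g - p'%:~R = - (sg * e') ->
    d * d = 1 -> q * p' - q' * p = d -> 0 < q -> 0 < q' -> 0 < n -> n < q' ->
  0 <= e -> e <= `|n%:~R * g - j%:~R|.
Proof.
move=> sg1 e'0 E E' d1 dE q0 q'0 n0 nq e0.
pose u := d * (n * p' - j * q'); pose v := d * (j * q - n * p).
have nE : n = u * q + v * q'.
  have -> : u * q + v * q' = d * (n * (q * p' - q' * p)) by rewrite /u /v; ring.
  by rewrite dE mulrCA d1 mulr1.
have jE : j = u * p + v * p'.
  have -> : u * p + v * p' = d * (j * (q * p' - q' * p)) by rewrite /u /v; ring.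
  by rewrite dE mulrCA d1 mulr1.
move: u v nE jE => u v nE jE {d1 dE d}.
(* The two errors have opposite signs, so coordinates of opposite signs make the contributions add
   up; [u] is nonzero since [n] is no multiple of [q']. *)
have -> : n%:~R * g - j%:~R = sg * (u%:~R * e - v%:~R * e').
  have -> : n%:~R * g - j%:~R =
      u%:~R * (q%:~R * g - p%:~R) + v%:~R * (q'%:~R * g - p'%:~R).
    by rewrite nE jE !intrD !intrM; ring.
  by rewrite E E'; ring.
rewrite normrM sg1 mul1r.
have [u1|u0] := lerP 1 u.
  have v0 : v <= 0 by rewrite leNgt; apply/negP => v1; nia.
  apply: le_trans (ler_norm _).
  have h1 : 0 <= (u%:~R - 1) * e by rewrite mulr_ge0// subr_ge0 ler1z.
  have h2 : 0 <= - v%:~R * e' by rewrite mulr_ge0// oppr_ge0 lerz0.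
  lra.
have u1 : u <= -1.
  rewrite leNgt; apply/negP => um.
  have uE : u = 0 by lia.
  rewrite uE mul0r add0r in nE.
  by have [v1|v1] := lerP 1 v; nia.
have v0 : 0 <= v by rewrite leNgt; apply/negP => v1; nia.
rewrite -normrN; apply: le_trans (ler_norm _).
have h1 : 0 <= (- u%:~R - 1) * e.
  by rewrite mulr_ge0// subr_ge0 -mulrNz ler1z; lia.
have h2 : 0 <= v%:~R * e' by rewrite mulr_ge0// ler0z.
lra.
Qed.

(* Numerators and denominators of convergents share the recurrence
   [w m.+2 = c m * w m.+1 + w m]; they differ by the initial values. *)
Definition cf_rec (c : nat -> nat) (w0 w1 : nat) (m : nat) : nat :=
  (iteri m (fun i w => (w.2, c i * w.2 + w.1)%N) (w0, w1)).1.

Lemma cf_recSS c w0 w1 m :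
  cf_rec c w0 w1 m.+2 = (c m * cf_rec c w0 w1 m.+1 + cf_rec c w0 w1 m)%N.
Proof. by []. Qed.

Lemma cf_rec_gt0 c w0 w1 m : (0 < w0)%N -> (0 < w1)%N ->
  (0 < cf_rec c w0 w1 m)%N.
Proof.
move=> w00 w10; suff : (0 < cf_rec c w0 w1 m /\ 0 < cf_rec c w0 w1 m.+1)%N by case.
elim: m => [|m [h1 h2]]//; rewrite cf_recSS; split=> //.
by rewrite addn_gt0 h1 orbT.
Qed.

(** [deltaA] sees only the odd multiples [2k - 1]. Even coefficients give [w m.+2] the parity of
    [w m], so all denominators from 3 on occur among these multiples. *)
Lemma cf_rec_odd c w0 w1 m : (forall i, ~~ odd (c i)) -> odd w0 -> odd w1 ->
  odd (cf_rec c w0 w1 m).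
Proof.
move=> ec o0 o1; suff : odd (cf_rec c w0 w1 m) && odd (cf_rec c w0 w1 m.+1).
  by case/andP.
elim: m => [|m /andP[h1 h2]]; first exact/andP.
by rewrite cf_recSS h2 oddD oddM (negbTE (ec m)) h1.
Qed.

Lemma cf_rec_lt c w0 w1 m : (forall i, 0 < c i)%N -> (0 < w0 < w1)%N ->
  (cf_rec c w0 w1 m < cf_rec c w0 w1 m.+1)%N.
Proof.
move=> c0 /andP[w00 w01]; case: m => // m; rewrite cf_recSS.
have := cf_rec_gt0 c m w00 (ltn_trans w00 w01).
by have := c0 m; nia.
Qed.

(** Unimodularity, as [best_approximation] requires: for the initial values 3, 11 and 1, 4 the last
    factor is 1. *)
Lemma cf_rec_det c u0 u1 w0 w1 m :
  (cf_rec c u0 u1 m)%:Z * (cf_rec c w0 w1 m.+1)%:Z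
    - (cf_rec c u0 u1 m.+1)%:Z * (cf_rec c w0 w1 m)%:Z
  = (-1) ^+ m * (u0%:Z * w1%:Z - u1%:Z * w0%:Z).
Proof.
elim: m => [|m IH]; first by rewrite expr0 mul1r.
rewrite exprS -mulrA -IH !cf_recSS !PoszD !PoszM; ring.
Qed.

Lemma cf_rec_stage c w0 w1 k : (forall i, 0 < c i)%N -> (0 < w0 < w1)%N ->
  (w0 <= k)%N -> exists m, (cf_rec c w0 w1 m <= k < cf_rec c w0 w1 m.+1)%N.
Proof.
move=> c0 w01 w0k.
have gr m : (m <= cf_rec c w0 w1 m)%N.
  elim: m => // m IH; exact: leq_ltn_trans IH (cf_rec_lt m c0 w01).
pose P m := (cf_rec c w0 w1 m <= k)%N.
have exP : exists m, P m by exists 0%N.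
have ubP m : P m -> (m <= k)%N by apply: leq_trans.
case: (ex_maxnP exP ubP) => m Pm maxm; exists m; apply/andP; split=> //.
by rewrite ltnNge; apply/negP => /maxm; rewrite ltnn.
Qed.

(** * Condition C for bounded continued fractions *)

(** [x i] is the tail [0; c i, c i.+1, ...]. Fixing [c 0] forces [2 / 5 <= x 0], which the stage of
    the denominator 3 needs. *)
Definition cf_tails {R : realType} (c : nat -> nat) (x : nat -> R) : Prop :=
  [/\ c 0%N = 2%N, forall i, c i = 2%N \/ c i = 4%N,
      forall i, 0 <= x i <= 1 / 2 & forall i, x i * ((c i)%:R + x i.+1) = 1].

(* The number [0; 2, 1, 3, c 0, c 1, ...], whose convergents from the third
   one on are [cf_rec c 1 4 m / cf_rec c 3 11 m]. *)
Definition cf_value {R : realType} (x : nat -> R) : R :=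
  (4 + x 0%N) / (11 + 3 * x 0%N).

(** The absolute error of the convergent with denominator [cf_rec c 3 11 m], multiplied by that
    denominator; see [cf_value_err]. *)
Definition cf_err {R : realType} (x : nat -> R) (m : nat) : R :=
  (\prod_(i < m) x i) / (11 + 3 * x 0%N).

Lemma cf_errS {R : realType} (x : nat -> R) m :
  cf_err x m.+1 = x m * cf_err x m.
Proof. by rewrite /cf_err big_ord_recr/= mulrCA mulrA mulrC mulrA. Qed.

Lemma cf_tails_ge {R : realType} c (x : nat -> R) i : cf_tails c x ->
  2 / 9 <= x i.
Proof.
move=> [_ c24 x01 xE]; have /andP[h0 _] := x01 i; have /andP[_ h1] := x01 i.+1.
have := xE i; have [->|->] := c24 i; nra.
Qed.

Lemma cf_tails0_ge {R : realType} c (x : nat -> R) : cf_tails c x ->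
  2 / 5 <= x 0%N.
Proof.
move=> [c0 _ x01 xE]; have /andP[h0 _] := x01 0%N; have /andP[_ h1] := x01 1%N.
have := xE 0%N; rewrite c0; nra.
Qed.

Lemma cf_err_gt0 {R : realType} c (x : nat -> R) m : cf_tails c x ->
  0 < cf_err x m.
Proof.
move=> H.
have x0 i : 0 < x i by rewrite (lt_le_trans _ (cf_tails_ge i H))// divr_gt0.
rewrite divr_gt0//; first by rewrite prodr_gt0.
by have := x0 0%N; lra.
Qed.

Lemma cf_err0_le {R : realType} c (x : nat -> R) : cf_tails c x ->
  cf_err x 0 <= 5 / 61.
Proof.
move=> H; rewrite /cf_err big_ord0 div1r.
have h := cf_tails0_ge H.
(* The bound is the inverse of [11 + 3 * (2 / 5)]. *)
have -> : 5 / 61 = (61 / 5)^-1 :> R by field.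
by rewrite lef_pV2 ?posrE; lra.
Qed.

Lemma cf_errS_le {R : realType} c (x : nat -> R) m : cf_tails c x ->
  cf_err x m.+1 <= cf_err x m / 2.
Proof.
move=> H; rewrite cf_errS mulrC.
have [_ _ /(_ m)/andP[_ h] _] := H.
by have := cf_err_gt0 m H; nra.
Qed.

Lemma cf_err_le {R : realType} c (x : nat -> R) m : cf_tails c x ->
  cf_err x m <= 5 / 61.
Proof.
move=> H; elim: m => [|m IH]; first exact: cf_err0_le H.
by apply: le_trans IH; have := cf_errS_le m H; have := cf_err_gt0 m H; lra.
Qed.

(** The alternating products of tails satisfy the recurrence of [cf_rec], because
    [1 - x m * c m = x m * x m.+1]. *)
Lemma cf_value_err {R : realType} c (x : nat -> R) m : cf_tails c x ->
  (cf_rec c 3 11 m)%:R * cf_value x - (cf_rec c 1 4 m)%:R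
    = (-1) ^+ m * cf_err x m.
Proof.
move=> H; have h0 := cf_tails0_ge H.
have D0 : 11 + 3 * x 0%N != 0 by apply: lt0r_neq0; lra.
suff [] : (cf_rec c 3 11 m)%:R * cf_value x - (cf_rec c 1 4 m)%:R
      = (-1) ^+ m * cf_err x m /\
    (cf_rec c 3 11 m.+1)%:R * cf_value x - (cf_rec c 1 4 m.+1)%:R
      = (-1) ^+ m.+1 * cf_err x m.+1 by [].
elim: m => [|m [IH1 IH2]].
  split; rewrite /cf_value /cf_err ?big_ord1 ?big_ord0 ?expr0 ?expr1 /=;
    by rewrite /cf_rec/=; field.
split=> //; rewrite !cf_recSS !natrD !natrM.
transitivity ((c m)%:R * ((cf_rec c 3 11 m.+1)%:R * cf_value x
    - (cf_rec c 1 4 m.+1)%:R) +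
  ((cf_rec c 3 11 m)%:R * cf_value x - (cf_rec c 1 4 m)%:R)); first by ring.
rewrite IH1 IH2 !cf_errS !exprS.
have [_ _ _ /(_ m) E] := H.
transitivity ((-1) ^+ m * cf_err x m * (1 - x m * (c m)%:R)); first by ring.
by rewrite (_ : 1 - _ = x m * x m.+1); [ring | rewrite mulrDr in E; lra].
Qed.

Lemma cf_value_bounds {R : realType} c (x : nat -> R) : cf_tails c x ->
  9 / 25 <= cf_value x <= 3 / 8.
Proof.
move=> H; have h0 := cf_tails0_ge H; have [_ _ /(_ 0%N)/andP[_ h] _] := H.
have D0 : 0 < 11 + 3 * x 0%N by lra.
by rewrite /cf_value ler_pdivlMr// ler_pdivrMr//; apply/andP; split; lra.
Qed.

Lemma cf_value_nearest {R : realType} c (x : nat -> R) m (n j : int) :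
    cf_tails c x -> 0 < n -> n < (cf_rec c 3 11 m.+1)%:Z ->
  cf_err x m <= `|n%:~R * cf_value x - j%:~R|.
Proof.
move=> H n0 nQ.
have E1 := cf_value_err m H; have := cf_value_err m.+1 H.
rewrite exprS -mulrA mulN1r => E2.
have D := cf_rec_det c 3 11 1 4 m.
have d1 : (-1) ^+ m * (-1) ^+ m = 1 :> int.
  by rewrite -exprMn mulrNN mulr1 expr1n.
apply: (@best_approximation _ _ _ (cf_err x m.+1) ((-1) ^+ m)
  (cf_rec c 3 11 m)%:Z (cf_rec c 1 4 m)%:Z (cf_rec c 3 11 m.+1)%:Z
  (cf_rec c 1 4 m.+1)%:Z ((-1) ^+ m)) => //.
- by rewrite normrX normrN1 expr1n.
- exact: ltW (cf_err_gt0 _ H).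
- by rewrite D mulr1.
- by rewrite ltz_nat cf_rec_gt0.
- by rewrite ltz_nat cf_rec_gt0.
- exact: ltW (cf_err_gt0 _ H).
Qed.

(** A rational value times its denominator is an integer, against the positive lower bound at a
    stage beyond that denominator. *)
Lemma cf_value_irrational {R : realType} c (x : nat -> R) : cf_tails c x ->
  irrational (cf_value x).
Proof.
move=> H [r _ rE].
have c0 i : (0 < c i)%N by have [_ /(_ i)[->|->]] := H.
have d0 := denq_gt0 r.
have [m] := @cf_rec_stage c 3 11 (3 + `|denq r|)%N c0 erefl (leq_addr _ _).
move=> /andP[_ hm].
have := @cf_value_nearest _ c x m (denq r) (numq r) H d0 ltac:(lia).
have -> : (denq r)%:~R * cf_value x = (numq r)%:~R.
  by rewrite -rE /ratr mulrC divfK// intr_eq0 gt_eqF.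
by rewrite subrr normr0 leNgt (cf_err_gt0 m H).
Qed.

(** * Condition C from the errors of the convergents *)

Lemma deltaA_eq {R : realType} (A : R) k (i : int) :
    `|((2 * k)%:R - 1) * gammaA A - i%:~R| <= 1 / 2 ->
  deltaA A k = pi * `|((2 * k)%:R - 1) * gammaA A - i%:~R|.
Proof.
have [j [-> jmin]] := deltaA_min A k => hi.
congr (pi * _); apply: le_anti; rewrite jmin/=.
have [->//|ij] := eqVneq i j.
have h : 1 <= `|i%:~R - j%:~R| :> R.
  by rewrite -intrB -intr_norm ler1z; lia.
set u := _ * _ in hi *.
have := ler_distD u i%:~R (j%:~R : R); rewrite (distrC i%:~R u).
lra.
Qed.

(** Any value above the minimum bounds the second minimum, so the latter need not be identified. *)
Lemma alphaA_betaA_bounds {R : realType} (A a : R) k i j :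
    (1 <= i <= k)%N -> (1 <= j <= k)%N -> deltaA A i = a ->
    (forall l, (1 <= l <= k)%N -> a <= deltaA A l) -> a < deltaA A j ->
  alphaA A k = a /\ a <= betaA A k <= deltaA A j.
Proof.
move=> ik jk ia la aj.
have lba : lbound (deltas A k) a by move=> _ [l lk <-]; exact: la.
have alE : alphaA A k = a.
  apply: le_anti; apply/andP; split.
    by apply: ge_inf; [exists a | exists i].
  by apply: lb_le_inf => //; exists a, i.
have jin : (deltas A k `\` [set alphaA A k]) (deltaA A j).
  by split; [exists j | rewrite alE /= => jE; rewrite jE ltxx in aj].
split=> //; apply/andP; split.
  by apply: lb_le_inf; [exists (deltaA A j) | move=> _ [[l lk <-] _]; exact: la].
by apply: ge_inf => //; exists a => _ [[l lk <-] _]; exact: la.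
Qed.

(** Everything is measured in units of [pi], and the constants absorb one factor [pi < 4]:
    [FAplus_le] gives at most [pi ^ 2 * (a * b) / 2 < pi * (2 * (a * b))], and [FAminus_le] is
    treated likewise. *)
Lemma condC_of_bounds {R : realType} (A t a b d : R) k :
    2 <= t -> RA A ^+ 2 = 1 + t ^+ 2 -> 0 < a -> alphaA A k = pi * a ->
    pi * a <= betaA A k <= pi * b -> pi * d <= deltaA A k.+1 ->
    a + b <= 1 / 2 -> 2 * (a * b) <= d -> 4 * (a * a) <= d ->
  condC A k.
Proof.
move=> t2 RE a0 alE /andP[ab bb] hd ab2 hab haa.
have p0 := pi_gt0 R; have p4 := pihalf_lt2 R.
have {}ab2 : pi * a + pi * b <= pi / 2 by rewrite -mulrDr; nra.
have leab : a <= b by rewrite -(ler_pM2l p0); exact: le_trans bb.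
split; apply: lt_le_trans hd; rewrite alE.
- apply: le_lt_trans (FAplus_le t2 RE _ ab _) _; first by rewrite mulr_gt0.
    by rewrite (le_trans _ ab2)// lerD2l.
  have h : pi * a * betaA A k <= pi * a * (pi * b).
    by rewrite ler_wpM2l// mulr_ge0// ltW.
  have h1 : pi * (pi * (a * b)) < pi * (4 * (a * b)).
    by rewrite ltr_pM2l// ltr_pM2r; [lra | rewrite mulr_gt0// (lt_le_trans a0)].
  have h2 : pi * (2 * (a * b)) <= pi * d by rewrite ler_pM2l.
  lra.
- apply: le_lt_trans (FAminus_le t2 RE _ _) _; first by rewrite mulr_gt0.
    have : pi * a <= pi * b by rewrite ler_pM2l.
    lra.
  have h1 : pi * (pi * (a * a)) < pi * (4 * (a * a)).
    by rewrite ltr_pM2l// ltr_pM2r; [lra | rewrite mulr_gt0].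
  have h2 : pi * (4 * (a * a)) <= pi * d by rewrite ler_pM2l.
  rewrite expr2; lra.
Qed.

(** Up to the factor [pi]: for [k = 2] the second minimum is at most [g] and the next value is
    [2 - 5 * g]; for the other [k] in the stage of the denominator 3 the bounds are [2 - 5 * g] and
    [e1]. In the latter case [2 - 5 * g <= 1 / 5] and [2 / 5 * e <= e1] just fit together. *)
Lemma cf_err0_bounds {R : realType} c (x : nat -> R) : cf_tails c x ->
  let e := cf_err x 0 in let e1 := cf_err x 1 in let g := cf_value x in
  [/\ e < g, e + g <= 1 / 2, 2 * (e * g) <= 2 - 5 * g
    & 4 * (e * e) <= 2 - 5 * g] /\
  [/\ e < 2 - 5 * g, e + (2 - 5 * g) <= 1 / 2, 2 * (e * (2 - 5 * g)) <= e1
    & 4 * (e * e) <= e1].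
Proof.
move=> H /=; have /andP[g1 g2] := cf_value_bounds H.
have e61 := cf_err0_le H; have e0 := cf_err_gt0 0 H.
have e1E : 2 / 5 * cf_err x 0 <= cf_err x 1.
  by rewrite cf_errS ler_pM2r//; exact: cf_tails0_ge H.
move: (cf_err x 0) (cf_err x 1) (cf_value x) g1 g2 e61 e0 e1E.
move=> e e1 g g1 g2 e61 e0 e1E.
have eg : e * g <= e * (3 / 8) by rewrite ler_pM2l.
have ge : e * (9 / 25) <= e * g by rewrite ler_pM2l.
have ee : e * e <= e * (5 / 61) by rewrite ler_pM2l.
by split; split; lra.
Qed.

(** At a later stage [e'] is the minimum, [e] bounds the second one, and the next value is at least
    the third error. The margin comes from [2 * (5 / 61) < 2 / 9]. *)
Lemma cf_errS_bounds {R : realType} c (x : nat -> R) m : cf_tails c x ->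
  let e := cf_err x m in let e' := cf_err x m.+1 in
  [/\ e' < e, e' + e <= 1 / 2, 2 * (e' * e) <= cf_err x m.+2
    & 4 * (e' * e') <= cf_err x m.+2].
Proof.
move=> H /=; have e61 := cf_err_le m H; have e0 := cf_err_gt0 m.+1 H.
have ee := cf_errS_le m H.
have eS : 2 / 9 * cf_err x m.+1 <= cf_err x m.+2.
  by rewrite (cf_errS _ m.+1) ler_pM2r//; exact: cf_tails_ge H.
move: (cf_err x m) (cf_err x m.+1) (cf_err x m.+2) e61 e0 ee eS.
move=> e e' e'' e61 e0 ee eS.
have h1 : e' * e <= e' * (5 / 61) by rewrite ler_pM2l.
have h2 : e' * e' <= e' * (5 / 122) by rewrite ler_pM2l//; lra.
split; lra.
Qed.

Lemma deltaA_cf {R : realType} (A : R) c (x : nat -> R) i m :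
    cf_tails c x -> gammaA A = cf_value x -> ((2 * i).-1 = cf_rec c 3 11 m)%N ->
  deltaA A i = pi * cf_err x m.
Proof.
move=> H gE iE.
have i1 : (0 < 2 * i)%N by have := @cf_rec_gt0 c 3 11 m erefl erefl; lia.
have E : `|((2 * i)%:R - 1) * gammaA A - ((cf_rec c 1 4 m)%:Z)%:~R| = cf_err x m.
  rewrite -{1}(prednK i1) -natr1 addrK iE gE cf_value_err// normrM normrX.
  by rewrite normrN1 expr1n mul1r gtr0_norm// (cf_err_gt0 _ H).
by rewrite -E; apply: deltaA_eq; rewrite E; have := cf_err_le m H; lra.
Qed.

Lemma deltaA_cf_ge {R : realType} (A : R) c (x : nat -> R) i m :
    cf_tails c x -> gammaA A = cf_value x -> (1 <= i)%N ->
    ((2 * i).-1 < cf_rec c 3 11 m.+1)%N ->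
  pi * cf_err x m <= deltaA A i.
Proof.
move=> H gE i1 iQ; have [j [-> _]] := deltaA_min A i.
have i2 : (0 < 2 * i)%N by lia.
rewrite ler_pM2l ?pi_gt0// -{1}(prednK i2) -natr1 addrK gE.
by apply: (cf_value_nearest (n := (2 * i).-1%:Z) _ H); lia.
Qed.

Lemma deltaA1_cf {R : realType} (A : R) c (x : nat -> R) :
  cf_tails c x -> gammaA A = cf_value x -> deltaA A 1 = pi * cf_value x.
Proof.
move=> H gE; have /andP[g1 g2] := cf_value_bounds H.
have E : `|((2 * 1)%:R - 1) * gammaA A - (0 : int)%:~R| = cf_value x.
  rewrite subr0 gE (_ : (2 * 1)%:R - 1 = 1); last by ring.
  by rewrite mul1r ger0_norm//; lra.
by rewrite -E; apply: deltaA_eq; rewrite E; lra.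
Qed.

Lemma deltaA3_cf {R : realType} (A : R) c (x : nat -> R) :
  cf_tails c x -> gammaA A = cf_value x ->
  deltaA A 3 = pi * (2 - 5 * cf_value x).
Proof.
move=> H gE; have /andP[g1 g2] := cf_value_bounds H.
have E : `|((2 * 3)%:R - 1) * gammaA A - (2 : int)%:~R| = 2 - 5 * cf_value x.
  rewrite gE distrC (_ : (2 * 3)%:R - 1 = 5); last by ring.
  by rewrite ger0_norm//; lra.
by rewrite -E; apply: deltaA_eq; rewrite E; lra.
Qed.

Lemma cf_value_condC {R : realType} (A t : R) c (x : nat -> R) k :
    2 <= t -> RA A ^+ 2 = 1 + t ^+ 2 -> cf_tails c x ->
    gammaA A = cf_value x -> (2 <= k)%N ->
  condC A k.
Proof.
move=> t2 RE H gE k2.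
have cE i : ~~ odd (c i) by have [_ /(_ i)[->|->]] := H.
have c2 i : (2 <= c i)%N by have [_ /(_ i)[->|->]] := H.
have c0 i : (0 < c i)%N by rewrite (leq_trans _ (c2 i)).
have Qodd m : exists i, ((2 * i).-1)%N = cf_rec c 3 11 m.
  have oQ := @cf_rec_odd c 3 11 m cE erefl erefl.
  exists (cf_rec c 3 11 m).+1./2.
  by have := odd_double_half (cf_rec c 3 11 m); rewrite oQ; lia.
have [m /andP[Qk kQ]] := @cf_rec_stage c 3 11 (2 * k).-1 c0 erefl ltac:(lia).
have [i iE] := Qodd m.
have Q0 := @cf_rec_gt0 c 3 11 m erefl erefl.
have ik : (1 <= i <= k)%N by lia.
have iD := deltaA_cf H gE iE.
have lowk l : (1 <= l <= k)%N -> pi * cf_err x m <= deltaA A l.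
  by move=> /andP[l1 lk]; apply: (deltaA_cf_ge H gE l1); lia.
(* Passing to [k.+1] may leave the stage, but [2k + 1] stays below [cf_rec c 3 11 m.+2], since [c m]
   is at least 2. *)
have nextd : pi * cf_err x m.+1 <= deltaA A k.+1.
  apply: (deltaA_cf_ge H gE) => //; rewrite cf_recSS.
  have : (2 * cf_rec c 3 11 m.+1 <= c m * cf_rec c 3 11 m.+1)%N.
    by rewrite leq_mul2r c2 orbT.
  lia.
have em0 := cf_err_gt0 m H.
(* For positive [m] the previous convergent bounds [betaA]. The convergent before the denominator 3
   has the even denominator 2, which gives no [deltaA], so [m = 0] uses explicit values. *)
case: m => [|m] in Qk kQ iE iD Q0 lowk nextd em0 *; last first.
  have [lte hab h2 h4] := cf_errS_bounds m H.
  have [j jE] := Qodd m.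
  have jk : (1 <= j <= k)%N.
    have := @cf_rec_lt c 3 11 m c0 erefl.
    by have := @cf_rec_gt0 c 3 11 m erefl erefl; lia.
  have jD := deltaA_cf H gE jE.
  have aj : pi * cf_err x m.+1 < deltaA A j by rewrite jD ltr_pM2l ?pi_gt0.
  have [alE bE] := alphaA_betaA_bounds ik jk iD lowk aj.
  by rewrite jD in bE; exact: (condC_of_bounds t2 RE em0 alE bE nextd).
have [[a1 a2 a3 a4] [b1 b2 b3 b4]] := cf_err0_bounds H.
have [k3|k3] := leqP 3 k.
  have jD := deltaA3_cf H gE.
  have aj : pi * cf_err x 0 < deltaA A 3 by rewrite jD ltr_pM2l ?pi_gt0.
  have [alE bE] := alphaA_betaA_bounds ik (j := 3) k3 iD lowk aj.
  by rewrite jD in bE; exact: (condC_of_bounds t2 RE em0 alE bE nextd).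
have kE : k = 2%N by apply/eqP; rewrite eqn_leq k2 -ltnS k3.
subst k.
have jD := deltaA1_cf H gE.
have aj : pi * cf_err x 0 < deltaA A 1 by rewrite jD ltr_pM2l ?pi_gt0.
have [alE bE] := alphaA_betaA_bounds ik (j := 1) erefl iD lowk aj.
rewrite jD in bE.
apply: (condC_of_bounds (d := 2 - 5 * cf_value x) t2 RE em0 alE bE) => //.
by rewrite (deltaA3_cf H gE).
Qed.

(** * Coding of the unit interval *)

Definition doubling {R : realType} (z : R) : R :=
  if z < 1 / 2 then 2 * z else 2 * z - 1.

(** Both values are even, and their gap exceeds the variation of the tails, which lie in
    [0, 1/2]. *)
Definition digit {R : realType} (z : R) : nat :=
  (if (z < 1 / 2)%R then 2 else 4)%N.

Lemma doubling_itv {R : realType} (z : R) : 0 <= z <= 1 -> 0 <= doubling z <= 1.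
Proof.
by rewrite /doubling => /andP[? ?]; case: ltP => ?; apply/andP; split; lra.
Qed.

Fixpoint coding_iter {R : realType} (m : nat) (z : R) : R :=
  if m is m'.+1 then ((digit z)%:R + coding_iter m' (doubling z))^-1 else 0.

Lemma digitE {R : realType} (z : R) : digit z = 2%N \/ digit z = 4%N.
Proof. by rewrite /digit; case: ltP; [left | right]. Qed.

Lemma digit_ge2 {R : realType} (z : R) : 2 <= (digit z)%:R :> R.
Proof. by have [->|->] := digitE z; lra. Qed.

Lemma coding_iter_ge0 {R : realType} m (z : R) : 0 <= coding_iter m z.
Proof.
elim: m z => //= m IH z; rewrite invr_ge0 addr_ge0//.
Qed.

Lemma invD_contract {R : realType} (n u v : R) : 2 <= n -> 0 <= u -> 0 <= v ->
  `|(n + u)^-1 - (n + v)^-1| <= `|u - v| / 4.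
Proof.
move=> n2 u0 v0.
have -> : (n + u)^-1 - (n + v)^-1 = (v - u) / ((n + u) * (n + v)).
  by field; rewrite !gt_eqF; lra.
rewrite normrM distrC normfV ler_wpM2l// lef_pV2 ?posrE ?normr_gt0.
- by rewrite ger0_norm; nra.
- by rewrite gt_eqF//; nra.
- by [].
Qed.

(** Each digit is at least 2, so each level contracts by 4; the geometric bound makes the truncated
    continued fractions converge. *)
Lemma coding_iter_telescope {R : realType} m (z : R) :
  `|coding_iter m.+1 z - coding_iter m z| <= geometric 1 (1 / 4) m.
Proof.
rewrite /geometric/= mul1r.
elim: m z => [|m IH] z.
  rewrite /= subr0 addr0 expr0 normfV ger0_norm//.
  by rewrite invf_le1; have := digit_ge2 z; lra.
rewrite exprSr mul1r.
apply: le_trans (invD_contract (digit_ge2 z) (coding_iter_ge0 m.+1 _)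
  (coding_iter_ge0 m _)) _.
by rewrite ler_wpM2r// ?invr_ge0//; have := IH (doubling z); rewrite mul1r.
Qed.

Lemma cvg_coding_iter {R : realType} (z : R) : cvgn (fun m => coding_iter m z).
Proof.
pose u m := coding_iter m z.
rewrite -/u.
have -> : u = (fun m => u 0%N + series (telescope u) m).
  by apply/funext => m; exact: eq_sum_telescope.
apply: is_cvgD; first exact: is_cvg_cst.
apply: normed_cvg.
apply: series_le_cvg (is_cvg_geometric_series (a := 1) (z := 1 / 4) _).
- by move=> n /=; exact: normr_ge0.
- by move=> n; apply: geometric_ge0; lra.
- by move=> n; exact: coding_iter_telescope.
- by rewrite ger0_norm; lra.
Qed.

(* The number [0; digit z, digit (doubling z), ...]. *)
Definition coding {R : realType} (z : R) : R := limn (fun m => coding_iter m z).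

Lemma coding_ge0 {R : realType} (z : R) : 0 <= coding z.
Proof.
apply: limr_ge; first exact: cvg_coding_iter.
by apply: nearW => m; exact: coding_iter_ge0.
Qed.

Lemma codingE {R : realType} (z : R) :
  coding z = ((digit z)%:R + coding (doubling z))^-1.
Proof.
have d0 := digit_ge2 z; have c0 := coding_ge0 (doubling z).
apply: (@cvg_lim) => //; rewrite -(@cvg_shiftS _ _ ).
apply: cvgV; first by rewrite gt_eqF//; lra.
apply: cvgD; first exact: cvg_cst.
exact: cvg_coding_iter.
Qed.

Lemma coding_le {R : realType} (z : R) : coding z <= 1 / 2.
Proof.
rewrite codingE div1r lef_pV2 ?posrE//; have := digit_ge2 z;
  have := coding_ge0 (doubling z); lra.
Qed.

Definition coding_tail {R : realType} (z : R) (i : nat) : R :=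
  if i is i'.+1 then coding (iter i' doubling z) else (2 + coding z)^-1.

Definition coding_digit {R : realType} (z : R) (i : nat) : nat :=
  if i is i'.+1 then digit (iter i' doubling z) else 2%N.

Lemma coding_cf_tails {R : realType} (z : R) :
  cf_tails (coding_digit z) (coding_tail z).
Proof.
split=> [//|[|i]|[|i]|[|i]] /=.
- by left.
- exact: digitE.
- have h := coding_ge0 z.
  by rewrite invr_ge0 div1r lef_pV2 ?posrE; first apply/andP; try split; lra.
- by rewrite coding_ge0 coding_le.
- by rewrite mulVf// gt_eqF//; have := coding_ge0 z; lra.
- rewrite codingE mulVf// gt_eqF//.
  have := digit_ge2 (iter i doubling z); have := coding_ge0 (iter i.+1 doubling z).
  by rewrite /=; lra.
Qed.

(* Equal first digits: the doubling map divides the fifth power by [32],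
   whereas one step of the continued fraction loses a factor at most [25]. *)
Lemma coding_expansion {R : realType} (z z' : R) : 0 <= z <= 1 -> 0 <= z' <= 1 ->
  `|z - z'| ^+ 5 <= 25 * `|coding z - coding z'|.
Proof.
move=> hz hz'.
pose C := 25 * `|coding z - coding z'|; rewrite -/C.
(* The number of common digits is not bounded, so the induction is on a depth [n], with an error
   that vanishes in the limit. *)
suff H n : `|z - z'| ^+ 5 <= C + geometric 1 (1 / 32) n.
  have cu : (fun n => C + geometric 1 (1 / 32) n) @ \oo --> C + 0.
    by apply: cvgD; [exact: cvg_cst | apply: cvg_geometric; rewrite ger0_norm; lra].
  rewrite -[leRHS]addr0 -(cvg_lim _ cu)//; apply: limr_ge; last exact: nearW.
  by apply/cvg_ex; exists (C + 0).
rewrite /C /geometric/= mul1r {C}.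
elim: n z z' hz hz' => [|n IH] z z' hz hz'.
  rewrite expr0 (le_trans (y := 1)) ?lerDr ?mulr_ge0//.
  by rewrite exprn_ile1// ler_norml; apply/andP; split; lra.
have z5 : `|z - z'| ^+ 5 <= 1.
  by rewrite exprn_ile1// ler_norml; apply/andP; split; lra.
set y := coding (doubling z); set y' := coding (doubling z').
have y0 : 0 <= y := coding_ge0 _; have y1 : y <= 1 / 2 := coding_le _.
have y'0 : 0 <= y' := coding_ge0 _; have y'1 : y' <= 1 / 2 := coding_le _.
have d0 := digit_ge2 z; have d0' := digit_ge2 z'.
have d4 (u : R) : (digit u)%:R <= 4 :> R by have [->|->] := digitE u; lra.
have := d4 z; have := d4 z'; move=> {}d4 d4'.
have E : coding z - coding z' = ((digit z')%:R - (digit z)%:R + (y' - y)) /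
    (((digit z)%:R + y) * ((digit z')%:R + y')).
  by rewrite codingE (codingE z') -/y -/y'; field; rewrite !gt_eqF; lra.
(* Both factors are at most [4 + 1 / 2]. *)
have D25 : ((digit z)%:R + y) * ((digit z')%:R + y') <= 25 by nra.
have D0 : 0 < ((digit z)%:R + y) * ((digit z')%:R + y') by nra.
have lo : `|(digit z')%:R - (digit z)%:R + (y' - y)| <= 25 * `|coding z - coding z'|.
  rewrite E normrM normfV (gtr0_norm D0) mulrCA ler_peMr// ler_pdivlMr//.
  by rewrite mul1r.
have n0 : 0 <= (1 / 32 : R) ^+ n by rewrite exprn_ge0//; lra.
rewrite (exprS _ n).
have [dd|dd] := eqVneq (digit z) (digit z').
  have zz : z - z' = (doubling z - doubling z') / 2.
    move: dd; rewrite /digit /doubling.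
    by have [h|h] := ltP z (1 / 2); have [h'|h'] := ltP z' (1 / 2) => // _; field.
  have := IH _ _ (doubling_itv hz) (doubling_itv hz'); rewrite -/y -/y'.
  move: lo; rewrite dd subrr add0r (distrC y') => lo.
  have -> : `|z - z'| ^+ 5 = 1 / 32 * `|doubling z - doubling z'| ^+ 5.
    by rewrite zz normrM exprMn normfV (ger0_norm (_ : 0 <= 2 :> R))//; field.
  by have := normr_ge0 (coding z - coding z'); lra.
(* Distinct digits differ by 2 and the tails by at most 1/2; then the trivial bound [z5]
   suffices. *)
have : 1 <= `|(digit z')%:R - (digit z)%:R + (y' - y)|.
  move: dd; rewrite /digit.
  have [h|h] := ltP z (1 / 2); have [h'|h'] := ltP z' (1 / 2) => // _.
    by rewrite ger0_norm; lra.
  by rewrite ler0_norm; lra.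
by lra.
Qed.

(** * Points of AA *)

Lemma RA_gammaA_cube {R : realType} (t : R) : 0 < t ->
  let A := omega3 * t ^+ 3 in
  RA A ^+ 2 = 1 + t ^+ 2 /\ gammaA A = pi^-1 * atan t.
Proof.
move=> t0 /=; have o0 := @omega3_gt0 R.
have A0 : 0 < omega3 * t ^+ 3 by rewrite mulr_gt0// exprn_gt0.
have Ao : omega3 * t ^+ 3 / omega3 = t `^ 3.
  by rewrite mulrAC divff ?gt_eqF// mul1r -powR_mulrn// ltW.
split; last first.
  rewrite gammaAE// Ao -powRrM (_ : 3 * (1 / 3) = 1); last by field.
  by rewrite powRr1// ltW.
have -> : RA (omega3 * t ^+ 3) = Num.sqrt (1 + t ^+ 2).
  rewrite /RA RA_setE// Ao -powRrM (_ : 3 * (2 / 3) = 2); last by field.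
  rewrite powR_mulrn ?(ltW t0)//.
  by apply: (@getPex _ [set _]); eexists.
by rewrite sqr_sqrtr// addr_ge0// sqr_ge0.
Qed.

(** The hypothesis [9 / 25] exceeds the [5 / 14] of [atan2_lt]. *)
Lemma tan_pi_gt2 {R : realType} (g : R) : 9 / 25 <= g -> g < 1 / 2 ->
  2 < tan (pi * g).
Proof.
move=> g1 g2; have p0 := pi_gt0 R; have a2 := @atan2_lt R.
have a0 : 0 < atan 2 :> R by rewrite -[ltLHS]atan0 lt_atan.
have h : pi * (9 / 25) <= pi * g by rewrite ler_pM2l.
have h' : pi * g < pi * (1 / 2) by rewrite ltr_pM2l.
rewrite -[ltLHS]atanK ltr_tan ?in_itv/=; last 2 first.
- by apply/andP; split; lra.
- by apply/andP; split; lra.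
lra.
Qed.

(** Bounds the variation of [gammaA A] by that of [A]: [atan] is 1-Lipschitz, the cube expands
    distances beyond 2, and [pi^-1 <= 1 <= omega3]. *)
Lemma atan_cube_contract {R : realType} (u v : R) : 2 <= u -> 2 <= v ->
  `|pi^-1 * atan u - pi^-1 * atan v| <= `|omega3 * u ^+ 3 - omega3 * v ^+ 3|.
Proof.
wlog vu : u v / v <= u.
  move=> H u2 v2; have [vu|/ltW uv] := leP v u; first exact: H.
  by rewrite distrC [leRHS]distrC; apply: H.
move=> u2 v2; have p1 := pihalf_ge1 R.
have p0 := pi_gt0 R.
have o1 : 1 <= omega3 :> R by rewrite /omega3; lra.
have n1 : 0 <= pi^-1 * (atan u - atan v).
  by apply: mulr_ge0; [rewrite invr_ge0 ltW | rewrite subr_ge0 le_atan].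
have n2 : 0 <= omega3 * (u ^+ 3 - v ^+ 3).
  apply: mulr_ge0; first by lra.
  by rewrite subr_ge0 lerXn2r ?nnegrE//; lra.
rewrite -!mulrBr !ger0_norm//.
have h1 : atan u - atan v <= u - v.
  apply: le_trans (atan_sub_le _ vu) _; first by lra.
  rewrite ler_piMr ?subr_ge0// invf_le1 ?lerDl ?sqr_ge0//.
  by rewrite ltr_wpDr// sqr_ge0.
have h2 : u - v <= u ^+ 3 - v ^+ 3.
  have -> : u ^+ 3 - v ^+ 3 = (u - v) * (u ^+ 2 + u * v + v ^+ 2) by ring.
  rewrite ler_peMr ?subr_ge0//.
  have : 0 <= u ^+ 2 by rewrite sqr_ge0.
  have : 0 <= v ^+ 2 by rewrite sqr_ge0.
  nra.
have h3 : u ^+ 3 - v ^+ 3 <= omega3 * (u ^+ 3 - v ^+ 3).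
  by rewrite ler_peMl// (le_trans _ h2)// subr_ge0.
apply: le_trans h3; apply: le_trans h2; apply: le_trans h1.
rewrite ler_piMl ?subr_ge0 ?le_atan// invf_le1//; lra.
Qed.

(** [cf_value] is a homography of determinant -1 in [x 0], with denominators at most
    [11 + 3 / 2 <= 13]. *)
Lemma cf_value_expansion {R : realType} c c' (x x' : nat -> R) :
    cf_tails c x -> cf_tails c' x' ->
  `|x 0%N - x' 0%N| <= 169 * `|cf_value x - cf_value x'|.
Proof.
move=> [_ _ /(_ 0%N)/andP[h1 h2] _] [_ _ /(_ 0%N)/andP[h1' h2'] _].
rewrite /cf_value; move: (x 0%N) (x' 0%N) h1 h2 h1' h2' => u v u0 u1 v0 v1.
have -> : (4 + u) / (11 + 3 * u) - (4 + v) / (11 + 3 * v) =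
    (v - u) / ((11 + 3 * u) * (11 + 3 * v)) by field; rewrite !gt_eqF; lra.
have D0 : 0 < (11 + 3 * u) * (11 + 3 * v) by rewrite mulr_gt0; lra.
rewrite normrM normfV (gtr0_norm D0) (distrC v) mulrCA ler_peMr//.
rewrite ler_pdivlMr// mul1r.
have -> : 169 = 13 * 13 :> R by ring.
by apply: ler_pM; lra.
Qed.

Lemma coding_tail_expansion {R : realType} (z z' : R) :
  `|coding z - coding z'| <= 9 * `|coding_tail z 0 - coding_tail z' 0|.
Proof.
have := coding_ge0 z; have := coding_ge0 z'.
have := coding_le z; have := coding_le z'.
rewrite /coding_tail; move: (coding z) (coding z') => u v v1 u1 v0 u0.
have -> : (2 + u)^-1 - (2 + v)^-1 = (v - u) / ((2 + u) * (2 + v)).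
  by field; rewrite !gt_eqF; lra.
have D0 : 0 < (2 + u) * (2 + v) by rewrite mulr_gt0; lra.
rewrite normrM normfV (gtr0_norm D0) (distrC v) mulrCA ler_peMr//.
rewrite ler_pdivlMr// mul1r.
have -> : 9 = 3 * 3 :> R by ring.
by apply: ler_pM; lra.
Qed.

(** Solves [gammaA A = cf_value (coding_tail z)] for [A], using [RA_gammaA_cube]. *)
Definition AA_point {R : realType} (z : R) : R :=
  omega3 * tan (pi * cf_value (coding_tail z)) ^+ 3.

Lemma AA_point_spec {R : realType} (z : R) (A := AA_point z)
    (t := tan (pi * cf_value (coding_tail z))) :
  [/\ 2 < t, RA A ^+ 2 = 1 + t ^+ 2, gammaA A = pi^-1 * atan t
    & gammaA A = cf_value (coding_tail z)].
Proof.
have /andP[g1 g2] := cf_value_bounds (coding_cf_tails z).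
set g := cf_value _ in g1 g2 t *.
have t2 : 2 < t by apply: tan_pi_gt2 => //; lra.
have [RE gE] := @RA_gammaA_cube R t (lt_trans (ltr0Sn _ 1) t2).
split=> //; rewrite /A/AA_point gE /t tanK ?mulKf ?gt_eqF ?pi_gt0//.
have p0 := pi_gt0 R.
have h : 0 < pi * g by rewrite mulr_gt0//; lra.
have h' : pi * g < pi * (1 / 2) by rewrite ltr_pM2l//; lra.
by rewrite in_itv/=; apply/andP; split; lra.
Qed.

Lemma AA_point_AA {R : realType} (z : R) : AA (AA_point z).
Proof.
have [t2 RE _ gE] := AA_point_spec z.
have H := coding_cf_tails z.
split.
- rewrite /AA_point mulrC ltr_pM2l ?omega3_gt0//.
  have -> : 8 = 2 ^+ 3 :> R by ring.
  by rewrite ltrXn2r// ?nnegrE//; lra.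
- by rewrite gE; exact: cf_value_irrational H.
- by move=> k k2; exact: cf_value_condC (ltW t2) RE H gE k2.
Qed.

Lemma AA_point_expansion {R : realType} (z z' : R) :
    0 <= z <= 1 -> 0 <= z' <= 1 ->
  `|z - z'| ^+ 5 <= 25 * (9 * 169) * `|AA_point z - AA_point z'|.
Proof.
move=> hz hz'.
have [t2 _ gE gE'] := AA_point_spec z; have [s2 _ hE hE'] := AA_point_spec z'.
apply: le_trans (coding_expansion hz hz') _; rewrite -!mulrA ler_pM2l//.
apply: le_trans (coding_tail_expansion z z') _; rewrite ler_pM2l//.
apply: le_trans (cf_value_expansion (coding_cf_tails z) (coding_cf_tails z')) _.
rewrite ler_pM2l// -gE' -hE' gE hE.
exact: atan_cube_contract (ltW t2) (ltW s2).
Qed.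

(** * Hausdorff dimension *)

Lemma diam_ge0 {R : realType} (U : set R) : U !=set0 -> (0 <= diam U)%E.
Proof.
move=> [x Ux]; apply: le_ereal_sup_tmp; exists 0%E => //.
by exists (x, x) => //=; rewrite subrr normr0.
Qed.

Lemma dist_le_diam {R : realType} (U : set R) x y : U x -> U y ->
  (`|x - y|%:E <= diam U)%E.
Proof. by move=> Ux Uy; apply: ereal_sup_ubound; exists (x, y). Qed.

Lemma hausdorff_gauge_ge0 {R : realType} s (U : set R) :
  (0 <= hausdorff_gauge s U)%E.
Proof. by rewrite /hausdorff_gauge; case: ifP => // _; exact: poweR_ge0. Qed.

(* The inverse of [f] is (1/n)-Hoelder: pulled back to [0, 1], a set of diameter
   [D <= 1] lies in an interval of length [2 (K D)^(1/n) <= 2 K^(1/n) D^s]. *)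
Lemma preimage_cover {R : realType} (f : R -> R) (K s : R) (n : nat)
    (U : set R) :
    (0 < n)%N -> 0 <= K -> 0 <= s <= n%:R^-1 ->
    (forall z z', 0 <= z <= 1 -> 0 <= z' <= 1 ->
      `|z - z'| ^+ n <= K * `|f z - f z'|) ->
    (diam U <= 1%:E)%E ->
  exists G : set R, [/\ measurable G, forall z, 0 <= z <= 1 -> U (f z) -> G z
    & (lebesgue_measure G <= (2 * K `^ n%:R^-1)%:E * hausdorff_gauge s U)%E].
Proof.
move=> n0 K0 /andP[s0 sn] fK U1.
have [[z0 [z01 Uz0]]|noz] := pselect (exists z, 0 <= z <= 1 /\ U (f z)); last first.
  exists set0; split=> //; first by move=> z z1 Uz; apply: noz; exists z.
  by rewrite measure0 mule_ge0 ?hausdorff_gauge_ge0// lee_fin mulr_ge0// powR_ge0.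
have U0 : U !=set0 by exists (f z0).
have D0 := diam_ge0 U0.
have [D DE] : exists D : R, diam U = D%:E.
  by move: D0 U1; case: (diam U) => // D _ _; exists D.
rewrite DE !lee_fin in D0 U1.
pose r := K `^ n%:R^-1 * D `^ s.
have r0 : 0 <= r by rewrite mulr_ge0 ?powR_ge0.
exists `[z0 - r, z0 + r]%classic; split; first exact: measurable_itv.
- move=> z z1 Uz; rewrite /= in_itv/= -ler_distlC.
  have h : `|z0 - z| ^+ n <= K * D.
    apply: le_trans (fK _ _ z01 z1) _; rewrite ler_wpM2l//.
    by rewrite -lee_fin -DE dist_le_diam.
  have -> : `|z0 - z| = (`|z0 - z| ^+ n) `^ n%:R^-1.
    by rewrite -powR_mulrn// -powRrM divff ?powRr1// pnatr_eq0 -lt0n.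
  apply: le_trans (_ : (K * D) `^ n%:R^-1 <= _).
    by rewrite ge0_ler_powR ?invr_ge0// nnegrE// ?exprn_ge0// mulr_ge0.
  rewrite powRM// ler_wpM2l ?powR_ge0//.
  (* Comparing exponents requires a positive base; for [D = 0] the left side vanishes as [n] is
     positive. *)
  have [->|DN0] := eqVneq D 0.
    by rewrite powR0 ?invr_eq0 ?pnatr_eq0 -?lt0n// powR_ge0.
  by apply: ger_powR => //; rewrite U1 andbT lt_neqAle eq_sym DN0.
- rewrite /hausdorff_gauge ifF; last exact/negbTE/set0P.
  rewrite DE poweR_EFin lebesgue_measure_itv/=.
  case: ifP => _; last first.
    by rewrite lee_fin mulr_ge0 ?powR_ge0// mulr_ge0 ?powR_ge0.
  by rewrite -EFinB -EFinM lee_fin /r le_eqVlt; apply/orP; left; apply/eqP; ring.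
Qed.

(** The sets pulled back from a cover of [E] cover [0, 1], so their Lebesgue measures add up to at
    least 1. Mesh 1 is the bound on diameters that [preimage_cover] asks for. *)
Lemma hausdorff_content_ge {R : realType} (E : set R) (f : R -> R) (K s : R)
    (n : nat) :
    (0 < n)%N -> 0 < K -> 0 <= s <= n%:R^-1 ->
    (forall z, 0 <= z <= 1 -> E (f z)) ->
    (forall z z', 0 <= z <= 1 -> 0 <= z' <= 1 ->
      `|z - z'| ^+ n <= K * `|f z - f z'|) ->
  ((2 * K `^ n%:R^-1)^-1%:E <= hausdorff_content s 1 E)%E.
Proof.
move=> n0 K0 sn fE fK; apply: le_ereal_inf_tmp => _ [F [EF F1] <-].
have [G GP] := choice (fun i => preimage_cover n0 (ltW K0) sn fK (F1 i)).
set C := 2 * _; have C0 : 0 < C by rewrite mulr_gt0// powR_gt0.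
have cov : `[0, 1]%classic `<=` \bigcup_i G i.
  move=> z; rewrite /= in_itv/= => z1; have [i _ Fi] := EF _ (fE z z1).
  by exists i => //; have [_ h _] := GP i; exact: h.
have : (lebesgue_measure (`[0%R, 1%R]%classic : set R) <=
    \sum_(i <oo) lebesgue_measure (G i))%E.
  apply: measure_sigma_subadditive => //.
  by move=> i; have [] := GP i.
rewrite lebesgue_measure_itv/= lte_fin ltr01 oppr0 adde0 => h.
have : (1 <= \sum_(i <oo) (C%:E * hausdorff_gauge s (F i)))%E.
  apply: le_trans h _; apply: lee_nneseries => i _ //.
  by have [] := GP i.
rewrite nneseriesZl; last by move=> i _; exact: hausdorff_gauge_ge0.
by rewrite -lee_pdivrMl// mule1.
Qed.

Lemma hausdorff_dim_ge {R : realType} (E : set R) (f : R -> R) (K : R) (n : nat) :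
    (0 < n)%N -> 0 < K -> (forall z, 0 <= z <= 1 -> E (f z)) ->
    (forall z z', 0 <= z <= 1 -> 0 <= z' <= 1 ->
      `|z - z'| ^+ n <= K * `|f z - f z'|) ->
  ((n%:R^-1)%:E <= hausdorff_dim E)%E.
Proof.
move=> n0 K0 fE fK; apply: le_ereal_inf_tmp => _ [s [s0 Es] <-].
rewrite lee_fin leNgt; apply/negP => sn.
have := @hausdorff_content_ge R E f K s n n0 K0 _ fE fK.
rewrite s0 ltW// => /(_ erefl) h.
(* The measure is a supremum over meshes, so mesh 1 alone keeps it positive. *)
have : (hausdorff_content s 1 E <= hausdorff_measure s E)%E.
  by apply: ereal_sup_ubound; exists 1 => //=; exact: ltr01.
rewrite Es => /(le_trans h); rewrite lee_fin leNgt invr_gt0.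
by rewrite mulr_gt0// powR_gt0.
Qed.

Theorem mainTheorem3 (R : realType) : (0 < hausdorff_dim (@AA R))%E.
Proof.
apply: lt_le_trans (hausdorff_dim_ge (f := AA_point) (K := 25 * (9 * 169))
  (n := 5) _ _ _ _) => //.
- by move=> z _; exact: AA_point_AA.
- exact: AA_point_expansion.
Qed.
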